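(* Let $d\ge 1$ and let $P\subset\mathbb{R}^d$ be a $d$-dimensional lattice polytope with Ehrhart polynomial $i_P(n)=c_d n^d+\dots+c_1n+c_0$. Then \[ \binom{d}{\ell}\,\Delta^k i_P(0)\ \le\ \binom{d}{k}\,\Delta^\ell i_P(0)\qquad\text{for all } 0\le k<\ell\le d . \] In particular, \[ \binom{d}{k}\ \le\ \Delta^k i_P(0)\ \le\ \binom{d}{k}\, d!\, c_d\qquad\text{for all } 0\le k\le d . \]
   Context: A lattice polytope is a convex polytope whose vertices have integer coordinates. Its Ehrhart polynomial $i_P$ is the polynomial satisfying $i_P(n)=\#(nP\cap\mathbb{Z}^d)$ for all nonnegative integers $n$. The difference operator is defined by $\Delta f(n)=f(n+1)-f(n)$, $\Delta^0 f=f$, and $\Delta^k f=\Delta(\Delta^{k-1}f)$ for $k\ge1$. *)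

(* Defs.v *)
From HB Require Import structures.
From mathcomp Require Export all_boot all_order all_algebra.
From mathcomp Require Export finmap.
From mathcomp Require Export all_classical all_reals.

Set Implicit Arguments.
Unset Strict Implicit.
Unset Printing Implicit Defensive.

Import Order.TTheory GRing.Theory Num.Theory.

Local Open Scope classical_set_scope.
Local Open Scope ring_scope.

Section ConvexGeometry.
Variables (R : realType) (d : nat).
Implicit Types (A P : set 'rV[R]_d) (v : 'rV[R]_d).

Definition convex_hull A : set 'rV[R]_d :=
  [set x | exists (m : nat) (a : 'I_m -> 'rV[R]_d) (w : 'I_m -> R),
     [/\ forall i, A (a i), forall i, 0 <= w i,
         \sum_i w i = 1 & x = \sum_i w i *: a i]].

Definition affine_hull A : set 'rV[R]_d :=
  [set x | exists (m : nat) (a : 'I_m -> 'rV[R]_d) (w : 'I_m -> R),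
     [/\ forall i, A (a i), \sum_i w i = 1 & x = \sum_i w i *: a i]].

Definition is_polytope P : Prop :=
  exists2 S : set 'rV[R]_d, finite_set S & P = convex_hull S.

(* The vertices of a polytope are its extreme points. *)
Definition is_vertex P v : Prop :=
  P v /\ forall (x y : 'rV[R]_d) (t : R), P x -> P y -> 0 < t < 1 ->
    v = t *: x + (1 - t) *: y -> x = v /\ y = v.

Definition integer_lattice : set 'rV[R]_d :=
  range (map_mx intr : 'rV[int]_d -> 'rV[R]_d).

Definition is_lattice_polytope P : Prop :=
  is_polytope P /\ forall v, is_vertex P v -> integer_lattice v.

(* The dimension of P is that of its affine hull, a translate x0 + U of a
   linear subspace; the empty set has no dimension in this sense. *)
Definition has_dimension P (m : nat) : Prop :=
  exists (x0 : 'rV[R]_d) (U : {vspace 'rV[R]_d}),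
    affine_hull P = [set x0 + u | u in [set` U]] /\ \dim U = m.

Definition dilate (n : nat) P : set 'rV[R]_d := [set n%:R *: x | x in P].

(* [fset_set] is the empty set on infinite sets, but the set below is finite
   whenever P is a polytope. *)
Definition lattice_count P (n : nat) : nat :=
  #|` fset_set (dilate n P `&` integer_lattice)|.

Definition is_ehrhart_poly P (p : {poly R}) : Prop :=
  forall n : nat, p.[n%:R] = (lattice_count P n)%:R.

End ConvexGeometry.

Definition fdiff (R : realType) (f : nat -> R) : nat -> R :=
  fun n => f n.+1 - f n.

Definition fdiffn (R : realType) (k : nat) (f : nat -> R) : nat -> R :=
  iter k (@fdiff R) f.

(* Main.v *)
(** Homogenize: put the lattice vertices [v_i] of [P] at height 1, as the rows
    [(1, v_i)] of a matrix [A].  Every point of the cone over [P] has a unique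
    lexicographically maximal nonnegative representation [mu *m A], and the
    supports of these representations form a triangulation.  Pushing all points
    by an infinitesimal multiple of a generic vector [y] of the cone turns the
    full-dimensional simplicial cones into half-open ones that partition the
    cone.  In a half-open simplicial cone each lattice point is, uniquely, a
    lattice point of a half-open box, of some height [j <= d], plus a natural
    combination of the generators, so that [i_P(n)] is a sum of terms
    [C(n + d - j, d)] (nonnegativity of the h*-vector).  Then
    [Delta^k i_P(0)] is the sum of the
    [C(d - j, d - k) = C(d, k) C(k, j) / C(d, j)], and the inequality
    holds termwise since [C(k, j)] increases with [k]. *)
Require Import Defs.
From mathcomp Require Import ring lra zify.

Set Implicit Arguments.
Unset Strict Implicit.
Unset Printing Implicit Defensive.

Import Order.TTheory GRing.Theory Num.Theory.
Local Open Scope classical_set_scope.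
Local Open Scope ring_scope.

(** * Lexicographic triangulation *)

Section Lex.
Variables (R : realType) (m : nat).
Implicit Types mu nu : 'rV[R]_m.

(** The strict lexicographic order enters only through its positive cone: [nu] beats [mu] when
    [lexpos (nu - mu)]. *)
Definition lexpos mu : Prop :=
  exists2 i, 0 < mu 0 i & forall j : 'I_m, (j < i)%N -> mu 0 j = 0.

Lemma lexpos_total mu : mu != 0 -> lexpos mu \/ lexpos (- mu).
Proof.
move=> mu0.
have [i0 i0P] : exists i, mu 0 i != 0.
  apply/existsP; apply: contraNT mu0; rewrite negb_exists => /forallP mu0.
  by apply/eqP/rowP => i; rewrite mxE; apply/eqP; move: (mu0 i); rewrite negbK.
have [i iN0 imin] := @arg_minnP _ i0 (fun i => mu 0 i != 0) val i0P.
have lt0 (j : 'I_m) : (j < i)%N -> mu 0 j = 0.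
  by move=> ji; apply/eqP/negP => /negP /imin; rewrite leqNgt ji.
case: (ltrgtP (mu 0 i) 0) iN0 => // mui _; [right|left]; exists i => //.
  by rewrite mxE oppr_gt0.
by move=> j ji; rewrite mxE lt0 ?oppr0.
Qed.

Lemma lexposD mu nu : lexpos mu -> lexpos nu -> lexpos (mu + nu).
Proof.
move=> [i mui ilt] [j nuj jlt].
have [ij|ji|/val_inj ij] := ltngtP i j.
- exists i; first by rewrite mxE jlt ?addr0.
  by move=> k ki; rewrite mxE ilt // jlt ?addr0 // (ltn_trans ki).
- exists j; first by rewrite mxE ilt ?add0r.
  by move=> k ki; rewrite mxE ilt ?jlt ?addr0 // (ltn_trans ki).
- subst j; exists i; first by rewrite mxE addr_gt0.
  by move=> k ki; rewrite mxE ilt ?jlt ?addr0.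
Qed.

Lemma lexposZ t mu : 0 < t -> lexpos mu -> lexpos (t *: mu).
Proof.
move=> t0 [i mui ilt]; exists i; first by rewrite mxE mulr_gt0.
by move=> j ji; rewrite mxE ilt ?mulr0.
Qed.

Lemma lexpos_max (T : finType) (P : T -> Prop) (f : T -> 'rV[R]_m) :
  (exists x, P x) ->
  exists2 x, P x & forall y, P y -> ~ lexpos (f y - f x).
Proof.
move=> [x0 Px0].
suff H (s : seq T) : exists2 x, P x & forall y, y \in s -> P y -> ~ lexpos (f y - f x).
  have [x Px xm] := H (enum T); exists x => // y; apply: xm.
  by rewrite mem_enum.
elim: s => [|z s [x Px xm]]; first by exists x0.
have [[Pz zx]|nz] := pselect (P z /\ lexpos (f z - f x)).
  exists z => // y; rewrite inE => /predU1P[-> _|ys Py yz].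
    by rewrite subrr => -[i]; rewrite mxE ltxx.
  by apply: (xm y ys Py); have := lexposD yz zx; rewrite subrKA.
exists x => // y; rewrite inE => /predU1P[-> Pz zx|]; last exact: xm.
exact: nz.
Qed.

End Lex.

(** Lets finitely many conditions hold for all sufficiently small [e] at once: the minimum of the
    thresholds serves. *)
Lemma finite_threshold (R : realType) (T : finType) (Q : T -> R -> Prop) :
  (forall i, exists2 e0 : R, 0 < e0 & forall e, 0 < e -> e < e0 -> Q i e) ->
  exists2 e0 : R, 0 < e0 & forall e, 0 < e -> e < e0 -> forall i, Q i e.
Proof.
move=> H.
have {}H i : exists e0 : R, 0 < e0 /\ forall e, 0 < e -> e < e0 -> Q i e.
  by have [e0 ? ?] := H i; exists e0.
have [f fP] := choice H.
exists (\big[Num.min/1]_i f i).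
  by apply/bigmin_gtP; split=> // i _; case: (fP i).
move=> e e0 ef i; apply: (fP i).2 => //; apply: lt_le_trans ef _.
exact: bigmin_le.
Qed.

Section Triangulation.
Variables (R : realType) (m d : nat) (A : 'M[R]_(m, d.+1)).
Hypothesis A0 : forall i, A i 0 = 1.
Implicit Types (mu nu : 'rV[R]_m) (x y : 'rV[R]_d.+1) (s : {set 'I_m}).

Definition nonneg mu := forall i, 0 <= mu 0 i.
Definition supp mu : {set 'I_m} := [set i | mu 0 i != 0]%SET.
Definition supported s mu := forall i, i \notin s -> mu 0 i = 0.
Definition independent s :=
  forall mu, supported s mu -> mu *m A = 0 -> mu = 0.

(* No feasible direction at a point with support [s] is a lexicographic
   improvement. *)
Definition optimal s :=
  forall mu, mu *m A = 0 -> (forall i, i \notin s -> 0 <= mu 0 i) ->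
    ~ lexpos mu.

Definition cone : set 'rV[R]_d.+1 :=
  [set x | exists2 mu, nonneg mu & x = mu *m A].

Lemma mulmx_height mu : (mu *m A) 0 0 = \sum_i mu 0 i.
Proof. by rewrite mxE; apply: eq_bigr => i _; rewrite A0 mulr1. Qed.

Lemma supported_supp mu : supported (supp mu) mu.
Proof. by move=> i; rewrite inE negbK => /eqP. Qed.

(** A nonzero kernel vector supported on [s] is feasible together with its opposite, and one of the
    two is [lexpos]. *)
Lemma optimal_independent s : optimal s -> independent s.
Proof.
move=> os mu sm mA; apply/eqP/negP => /negP /lexpos_total [].
  by apply: os => // i /sm ->.
by apply: os => [|i /sm mi]; rewrite ?mulNmx ?mA ?oppr0 // mxE mi oppr0.
Qed.

(** The difference of the representations is feasible at one of them and its opposite at the other;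
    if nonzero, one of the two would be an improvement. *)
Lemma optimal_unique mu nu : nonneg mu -> nonneg nu -> mu *m A = nu *m A ->
  optimal (supp mu) -> optimal (supp nu) -> mu = nu.
Proof.
have half mu' nu' : nonneg nu' -> mu' *m A = nu' *m A ->
    optimal (supp mu') -> ~ lexpos (nu' - mu').
  move=> n0 e om; apply: om => [|i]; first by rewrite mulmxBl e subrr.
  by move=> /supported_supp mi; rewrite !mxE mi subr0.
move=> m0 n0 e om on; apply/eqP; rewrite -subr_eq0.
apply/negP => /negP /lexpos_total; rewrite opprB => -[].
  exact: half.
exact: half.
Qed.

(** The rows have height 1, so the coordinates of a kernel vector sum to 0. *)
Lemma exists_neg mu : mu *m A = 0 -> mu != 0 -> exists i, mu 0 i < 0.
Proof.
move=> mA; apply: contraNP => /forallNP mN.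
have mu0 i : 0 <= mu 0 i by rewrite leNgt; apply/negP.
have : \sum_i mu 0 i = 0 by rewrite -mulmx_height mA mxE.
move/eqP; rewrite psumr_eq0 // => /allP mz.
apply/eqP/rowP => i; rewrite mxE; apply/eqP; apply: mz.
by rewrite mem_index_enum.
Qed.

(* Move along a kernel vector until a coordinate of the support vanishes. *)
Lemma shrink_support mu nu : nonneg mu -> nu *m A = 0 -> nu != 0 ->
  supported (supp mu) nu ->
  exists t, [/\ 0 < t, nonneg (mu + t *: nu) &
    (#|supp (mu + t *: nu)| < #|supp mu|)%N].
Proof.
move=> m0 nA nN0 sn; have [i0 i0P] := exists_neg nA nN0.
(* Ratio test: [i] is the first coordinate to vanish along the ray from [mu] in direction [nu]. *)
have [i iN imin] := @arg_minP _ _ _ i0 (fun i => nu 0 i < 0)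
  (fun i => - mu 0 i / nu 0 i) i0P.
have mpos j : nu 0 j < 0 -> 0 < mu 0 j.
  move=> nj; rewrite lt_neqAle m0 andbT eq_sym; apply/negP => /eqP mj.
  by move: nj; rewrite sn ?ltxx // inE mj eqxx.
set t := - mu 0 i / nu 0 i in imin.
have t0 : 0 < t by rewrite /t mulNr -mulrN -invrN divr_gt0 ?oppr_gt0 ?mpos.
exists t; split=> //.
  move=> j; rewrite !mxE; have [nj|nj] := ltP (nu 0 j) 0.
    by have := imin j nj; rewrite ler_ndivlMr //; lra.
  by apply: addr_ge0; [exact: m0|rewrite mulr_ge0 // ltW].
apply: proper_card; apply/properP; split.
  apply/fintype.subsetP => j; rewrite !inE !mxE; apply: contraNN => /eqP mj.
  by rewrite mj sn ?mulr0 ?addr0 // inE mj eqxx.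
exists i; first by rewrite inE gt_eqF ?mpos.
by rewrite inE !mxE /t divfK ?subrr ?eqxx // lt_eqF.
Qed.

Lemma caratheodory_lex mu : nonneg mu ->
  exists nu, [/\ nonneg nu, nu *m A = mu *m A, independent (supp nu) &
    nu = mu \/ lexpos (nu - mu)].
Proof.
have [n] := ubnP #|supp mu|; elim: n mu => // n IH mu mn m0.
have [im|] := pselect (independent (supp mu)).
  by exists mu; split=> //; left.
move=> /existsNP[nu] /not_implyP[sn] /not_implyP[nA] /eqP nN0.
(* With [nu] also [- nu] is a kernel vector, so the direction can be taken [lexpos]; each shrinking
   of the support then moves up lexicographically. *)
wlog ln : nu sn nA nN0 / lexpos nu => [H|].
  have [ln|ln] := lexpos_total nN0; first exact: (H nu).
  apply: (H (- nu)); rewrite ?mulNmx ?nA ?oppr0 ?oppr_eq0 //.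
  by move=> i /sn ni; rewrite mxE ni oppr0.
have [t [t0 tm tn]] := shrink_support m0 nA nN0 sn.
have [||nu' [n0' nA' in' ln']] := IH (mu + t *: nu) => //.
  exact: leq_trans tn _.
exists nu'; split=> //; first by rewrite nA' mulmxDl -scalemxAl nA scaler0 addr0.
right; have lt := lexposZ t0 ln.
case: ln' => [->|ln']; first by rewrite addrC addKr.
by have := lexposD ln' lt; rewrite opprD addrA subrK.
Qed.

Definition sel_mx s : 'M[R]_m := diag_mx (\row_i (i \in s)%:R).
(** The pseudoinverse makes this linear in [x] without case distinction; the value is meaningful
    only for [x] in the span of the rows in [s]. *)
Definition coords s x := x *m pinvmx (sel_mx s *m A) *m sel_mx s.

Lemma coords_supported s x : supported s (coords s x).
Proof.
by move=> i /negbTE si; rewrite /coords mul_mx_diag !mxE si mulr0.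
Qed.

Lemma supported_sel s mu : supported s mu -> mu *m sel_mx s = mu.
Proof.
move=> sm; apply/rowP => i; rewrite mul_mx_diag !mxE.
by have [si|/sm ->] := boolP (i \in s); rewrite ?mulr1 ?mul0r.
Qed.

Lemma supported_span s mu : supported s mu -> (mu *m A <= sel_mx s *m A)%MS.
Proof. by move=> sm; rewrite -(supported_sel sm) -mulmxA submxMl. Qed.

Lemma coordsK s x : (x <= sel_mx s *m A)%MS -> coords s x *m A = x.
Proof. by move=> xs; rewrite /coords -mulmxA mulmxKpV. Qed.

Lemma coords_mul s mu : independent s -> supported s mu ->
  coords s (mu *m A) = mu.
Proof.
move=> is_ sm; apply/eqP; rewrite -subr_eq0; apply/eqP/is_.
  by move=> i si; rewrite mxE coords_supported // mxE sm // subr0.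
by rewrite mulmxBl coordsK ?subrr // supported_span.
Qed.

Lemma coordsD s x y : coords s (x + y) = coords s x + coords s y.
Proof. by rewrite /coords !mulmxDl. Qed.

Lemma coordsZ s t x : coords s (t *: x) = t *: coords s x.
Proof. by rewrite /coords !scalemxAl. Qed.

Lemma coordsB s x y : coords s (x - y) = coords s x - coords s y.
Proof. by rewrite /coords !mulmxBl. Qed.

Lemma cone_optimal x : cone x ->
  exists mu, [/\ nonneg mu, x = mu *m A & optimal (supp mu)].
Proof.
move=> [mu0 mu0p xE].
have [nu0 [nu0p nu0A nu0i _]] := caratheodory_lex mu0p.
(* The representations of [x] may be infinite in number, so the maximum is taken over the finitely
   many candidates [coords s x]; Caratheodory reduction provides one. *)
have [|s [sp sA] smax] := @lexpos_max R m {set 'I_m}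
  (fun s => nonneg (coords s x) /\ coords s x *m A = x) (fun s => coords s x).
  exists (supp nu0); rewrite xE -nu0A coords_mul //; exact: supported_supp.
exists (coords s x); split=> // mu mA mpos lmu.
(* A small step along an improving [mu] stays nonnegative; reducing its support again gives a
   candidate above the maximum. *)
have [e e0 ep] : exists2 e, 0 < e & nonneg (coords s x + e *: mu).
  have [i|e0 e00 eP] := @finite_threshold R 'I_m
    (fun i e => 0 <= coords s x 0 i + e * mu 0 i).
    have [|ci0] := boolP (i \in supp (coords s x)).
      rewrite inE => ciN0.
      have ci : 0 < coords s x 0 i by rewrite lt_neqAle eq_sym ciN0 sp.
      exists (coords s x 0 i / (1 + `|mu 0 i|)); first by rewrite divr_gt0 // ltr_pwDl.
      move=> e e0; rewrite ltr_pdivlMr; last by rewrite ltr_pwDl.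
      have := ler_norm (- mu 0 i); rewrite normrN; nra.
    exists 1 => // e e0 _; apply: addr_ge0 (sp i) _.
    by rewrite mulr_ge0 ?mpos // ltW.
  exists (e0 / 2); first by rewrite divr_gt0.
  move=> i; rewrite mxE [X in _ + X]mxE; apply: eP; lra.
have [nu [nup nuA nui nul]] := caratheodory_lex ep.
have nuAx : nu *m A = x by rewrite nuA mulmxDl -scalemxAl mA scaler0 addr0.
have nuE : coords (supp nu) x = nu.
  by rewrite -nuAx coords_mul //; exact: supported_supp.
apply: (smax (supp nu)); rewrite nuE //.
have le := lexposZ e0 lmu.
case: nul => [->|nul]; first by rewrite addrC addKr.
by have := lexposD nul le; rewrite opprD addrA subrK.
Qed.

End Triangulation.

(** * Half-open decomposition *)

(** More points than the degree: among 1, ..., [size q] some integer is not a root. *)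
Lemma nonroot_pos (R : realType) (q : {poly R}) : q != 0 ->
  exists2 t, 0 < t & q.[t] != 0.
Proof.
move=> q0; apply: contrapT => qr.
pose rs : seq R := [seq i.+1%:R | i <- iota 0 (size q)].
have: (size rs < size q)%N.
  apply: max_poly_roots => //.
    apply/allP => _ /mapP[i _ ->]; apply/negP => /negP qi.
    by apply: qr; exists i.+1%:R.
  rewrite map_inj_uniq ?iota_uniq // => i j /eqP.
  by rewrite eqr_nat eqSS => /eqP.
by rewrite size_map size_iota ltnn.
Qed.

Section HalfOpen.
Variables (R : realType) (m d : nat) (A : 'M[R]_(m, d.+1)).
Hypothesis A0 : forall i, A i 0 = 1.
Implicit Types (mu nu : 'rV[R]_m) (x y : 'rV[R]_d.+1) (s : {set 'I_m}).

(* A point of the moment-like curve [t |-> \sum_i t ^+ i *: row i A] avoids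
   the finitely many proper subspaces spanned by rows. *)
Lemma exists_generic : row_full A ->
  exists2 y, cone A y &
    forall s, (y <= sel_mx R s *m A)%MS -> row_full (sel_mx R s *m A).
Proof.
move=> fA.
pose c (t : R) : 'rV[R]_m := \row_i t ^+ i.
(* For a proper span, [q] is a coordinate of the curve point modulo the span, as a polynomial in
   [t]; it is nonzero because some row of [A] lies outside the span. *)
have H s : exists q : {poly R}, q != 0 /\ forall t, (c t *m A <= sel_mx R s *m A)%MS ->
    ~~ row_full (sel_mx R s *m A) -> q.[t] = 0.
  have [fs|nfs] := boolP (row_full (sel_mx R s *m A)).
    by exists 1; split; [exact: oner_neq0|].
  set K := cokermx (sel_mx R s *m A).
  have AK : A *m K != 0.
    apply/negP => /eqP AK; move/row_fullP: fA => [B BA].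
    have K0 : K = 0 by rewrite -[K]mul1mx -BA -mulmxA AK mulmx0.
    move: nfs; rewrite -sub1mx => /negP; apply.
    by rewrite submxE -/K K0 mulmx0.
  have [i [j ij]] : exists i j, (A *m K) i j != 0.
    apply: contrapT => H; move/negP: AK; apply; apply/eqP/matrixP => i j.
    rewrite [RHS]mxE; apply: contrapT => /eqP ij; apply: H; by exists i, j.
  exists (\sum_(k < m) (A *m K) k j *: 'X^k); split.
    apply/negP => /eqP /(congr1 (fun p : {poly R} => p`_i)) /eqP.
    rewrite coef_sum coef0 (bigD1 i) //= big1 ?addr0.
      by rewrite coefZ coefXn eqxx mulr1 (negbTE ij).
    move=> k ki; rewrite coefZ coefXn -(inj_eq val_inj) /= in ki *.
    by rewrite eq_sym (negbTE ki) mulr0.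
  move=> t; rewrite submxE -/K -mulmxA => /eqP tK _.
  have /(congr1 (fun M : 'rV_d.+1 => M 0 j)) := tK.
  rewrite mxE [RHS]mxE => tK0; rewrite horner_sum -[RHS]tK0; apply: eq_bigr => k _.
  by rewrite hornerZ hornerXn [c t 0 k]mxE mulrC.
have [q qP] := choice H.
(* One parameter avoiding the roots of the product serves all [s]; its positivity puts the point in
   the cone. *)
have [|t t0 qt] := @nonroot_pos R (\prod_s q s).
  by apply/prodf_neq0 => s _; case: (qP s).
exists (c t *m A); first by exists (c t) => // i; rewrite mxE exprn_ge0 // ltW.
move=> s ys; apply/negP => /negP nf; case: (qP s) => _ /(_ _ ys nf) qs.
by move: qt; rewrite (bigD1 s) //= hornerM qs mul0r eqxx.
Qed.

Variable y : 'rV[R]_d.+1.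
Hypothesis coney : cone A y.
Hypothesis gen_y : forall s, (y <= sel_mx R s *m A)%MS ->
  row_full (sel_mx R s *m A).

(** These index the maximal simplices of the triangulation; optimality already makes their rows
    independent. *)
Definition facet s := optimal A s /\ row_full (sel_mx R s *m A).

(* The points [x] with [x + e *: y] in the interior of the simplicial cone
   over [s] for all small [e > 0]. *)
Definition half_open s x := forall i, i \in s ->
  0 <= coords A s x 0 i /\ (coords A s y 0 i <= 0 -> 0 < coords A s x 0 i).

Lemma facet_coordsK s x : facet s -> coords A s x *m A = x.
Proof. by move=> [_ fs]; rewrite coordsK // submx_full. Qed.

Lemma half_open_nonneg s x : half_open s x -> nonneg (coords A s x).
Proof.
move=> hx i; have [/hx[]//|si] := boolP (i \in s).
by rewrite coords_supported.
Qed.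

Lemma half_open_cone s x : facet s -> half_open s x -> cone A x.
Proof.
move=> fs hx; exists (coords A s x); last by rewrite facet_coordsK.
exact: half_open_nonneg.
Qed.

(** Each coordinate is affine in [e], and is positive at [e = 0] or zero there with positive
    slope. *)
Lemma half_open_interior s x : half_open s x ->
  exists2 e0 : R, 0 < e0 & forall e, 0 < e -> e < e0 ->
    forall i, i \in s -> 0 < coords A s (x + e *: y) 0 i.
Proof.
move=> hx; apply: finite_threshold => i.
have [si|_] := boolP (i \in s); last by exists 1.
have [ci cip] := hx i si; set cx := coords A s x 0 i in ci cip.
have cE e : coords A s (x + e *: y) 0 i = cx + e * coords A s y 0 i.
  by rewrite coordsD coordsZ mxE [X in _ + X]mxE.
set cy := coords A s y 0 i in cip cE.
have [cy0|cy0] := leP cy 0.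
  exists (cx / (1 - cy)); first by rewrite divr_gt0 ?cip //; lra.
  move=> e e0; rewrite ltr_pdivlMr ?cE; last by lra.
  by move=> h _; nra.
by exists 1 => // e e0 _ _; rewrite cE; nra.
Qed.

Lemma interior_supp s x : (forall i, i \in s -> 0 < coords A s x 0 i) ->
  supp (coords A s x) = s.
Proof.
move=> px; apply/setP => i; rewrite inE.
have [/px/gt_eqF->//|si] := boolP (i \in s).
by rewrite coords_supported ?eqxx.
Qed.

Lemma half_open_exists x : cone A x -> exists2 s, facet s & half_open s x.
Proof.
move=> [lx lx0 lxE]; have [ly ly0 lyE] := coney.
pose good s e := exists mu,
  [/\ nonneg mu, x + e *: y = mu *m A, optimal A (supp mu) & supp mu = s].
(* Pigeonhole on the finitely many supports: one [s] carries optimal representations of [x + e *: y]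
   for arbitrarily small [e]. *)
have [s sP] : exists s, forall e0 : R, 0 < e0 ->
    exists e, [/\ 0 < e, e < e0 & good s e].
  apply: contrapT => /forallNP ns.
  have [|e0 e00 e0P] := @finite_threshold R {set 'I_m} (fun s e => ~ good s e).
    move=> s; have /existsNP[e0 /not_implyP[e00 ne]] := ns s.
    exists e0 => // e e1 e2 ge; apply: ne; by exists e.
  have h0 : 0 < e0 / 2 by lra.
  have [|mu [mu0 muE muo]] := @cone_optimal R m d A A0 (x + (e0 / 2) *: y).
    exists (lx + (e0 / 2) *: ly); last by rewrite mulmxDl -scalemxAl lxE lyE.
    by move=> i; rewrite !mxE; apply: addr_ge0 => //; apply: mulr_ge0 => //; exact: ltW.
  have h1 : e0 / 2 < e0 by lra.
  by apply: (e0P _ h0 h1 (supp mu)); exists mu.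
have os : optimal A s.
  by have [//|e [_ _ [mu [_ _ o <-]]]] := sP 1.
have span e : good s e -> ((x + e *: y)%R <= sel_mx R s *m A)%MS.
  move=> [mu [_ -> _ <-]]; apply: supported_span; exact: supported_supp.
(* Two values of [e] give points of the span of [s] that differ by a nonzero multiple of [y];
   genericity then makes the span full. *)
have fs : row_full (sel_mx R s *m A).
  apply: gen_y; have [//|e [e0 _ /span ge]] := sP 1.
  have [//|e' [e'0 e'e /span ge']] := sP e.
  have ee : e - e' != 0 by rewrite subr_eq0 gt_eqF.
  rewrite -[y](scalerK ee) scalemx_sub //.
  have -> : (e - e') *: y = (x + e *: y) - (x + e' *: y).
    by rewrite opprD addrACA subrr add0r scalerBl.
  by rewrite addmx_sub ?eqmx_opp.
exists s => // i si.
have pos e0 : 0 < e0 -> exists e, [/\ 0 < e, e < e0 &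
    0 < coords A s x 0 i + e * coords A s y 0 i].
  move=> /sP[e [e1 e2 [mu [mu0 muE _ muS]]]]; exists e; split=> //.
  have -> : coords A s x 0 i + e * coords A s y 0 i = coords A s (x + e *: y) 0 i.
    by rewrite coordsD coordsZ [RHS]mxE [X in _ = _ + X]mxE.
  rewrite muE coords_mul; last by rewrite -muS; exact: supported_supp.
    by rewrite lt_neqAle mu0 andbT eq_sym; move: si; rewrite -muS inE.
  exact: optimal_independent.
(* Letting [e] tend to 0 in [0 < cx + e * cy] yields both sign conditions. *)
set cx := coords A s x 0 i in pos *; set cy := coords A s y 0 i in pos *.
split.
  rewrite leNgt; apply/negP => cx0.
  have [|e [e0 e1 e2]] := pos (- cx / (1 + `|cy|)).
    by rewrite divr_gt0 ?oppr_gt0 // ltr_pwDl.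
  move: e1; rewrite ltr_pdivlMr; last by rewrite ltr_pwDl.
  have := ler_norm cy; nra.
by move=> cy0; have [//|e [e0 _ e2]] := pos 1; nra.
Qed.

(** For small [e] the point [x + e *: y] is interior to both simplicial cones, so uniqueness of the
    optimal representation identifies the supports. *)
Lemma half_open_unique s s' x : facet s -> facet s' ->
  half_open s x -> half_open s' x -> s = s'.
Proof.
move=> fs fs' /half_open_interior[e0 e00 e0P] /half_open_interior[e1 e10 e1P].
pose e := Num.min e0 e1 / 2.
have m0 : 0 < Num.min e0 e1 by rewrite lt_min e00.
have e_0 : 0 < e by rewrite /e; lra.
have em : e < Num.min e0 e1 by rewrite /e; lra.
move: em; rewrite lt_min => /andP[ee0 ee1].
have p := e0P e e_0 ee0; have p' := e1P e e_0 ee1.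
rewrite -(interior_supp p) -(interior_supp p'); congr supp.
have nn s2 : (forall i, i \in s2 -> 0 < coords A s2 (x + e *: y) 0 i) ->
    nonneg (coords A s2 (x + e *: y)).
  move=> q i; have [/q/ltW//|si] := boolP (i \in s2).
  by rewrite coords_supported.
apply: (@optimal_unique R m d A); rewrite ?facet_coordsK ?interior_supp //.
- exact: nn.
- exact: nn.
- by case: fs.
- by case: fs'.
Qed.

End HalfOpen.

(** * Boxes *)

Definition unit_itv (R : realType) (open0 : bool) (r : R) : bool :=
  if open0 then 0 < r <= 1 else 0 <= r < 1.

Lemma unit_itv_decomp (R : realType) (o : bool) (c : R) :
  0 <= c -> (o -> 0 < c) -> exists k : nat, unit_itv o (c - k%:R).
Proof.
move=> c0 cp; pose k := Num.truncn c.
have /andP[k1 k2] : k%:R <= c < k.+1%:R by apply: truncn_itv.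
rewrite -natr1 in k2.
case: o cp => [/(_ isT) cp|_]; last by exists k; rewrite /unit_itv; lra.
(* For the interval open at 0, an integral [c] needs a shift one less than its integer part, which
   is positive since [0 < c]. *)
have [kc|kc] := eqVneq c k%:R; last first.
  by exists k; rewrite /unit_itv; move: k1; rewrite le_eqVlt eq_sym (negbTE kc) /= => k1; lra.
case: k kc {k1 k2} => [|k] kc; first by rewrite kc ltxx in cp.
by exists k; rewrite kc -natr1 /unit_itv; lra.
Qed.

Lemma unit_itv_unique (R : realType) (o : bool) (r : R) (k l : nat) :
  unit_itv o (r - k%:R) -> unit_itv o (r - l%:R) -> k = l.
Proof.
have aux (k' l' : nat) : unit_itv o (r - k'%:R) -> unit_itv o (r - l'%:R) ->
    (k' <= l')%N.
  move=> uk ul; rewrite leqNgt; apply/negP => lk.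
  have : l'.+1%:R <= k'%:R :> R by rewrite ler_nat.
  by rewrite -natr1; move: uk ul; rewrite /unit_itv; case: o; lra.
by move=> uk ul; apply/eqP; rewrite eqn_leq !aux.
Qed.

Section Box.
Variables (R : realType) (m d : nat) (A : 'M[R]_(m, d.+1)).
Hypothesis A0 : forall i, A i 0 = 1.
Variable y : 'rV[R]_d.+1.
Hypothesis coney : cone A y.
Hypothesis gen_y : forall s, (y <= sel_mx R s *m A)%MS ->
  row_full (sel_mx R s *m A).
Implicit Types (mu nu : 'rV[R]_m) (x b : 'rV[R]_d.+1) (s : {set 'I_m}).

(** The half-open fundamental parallelepiped of the cone over [s]: a side excludes 0 exactly where
    [half_open] demands a positive coordinate. *)
Definition in_box s b :=
  forall i, i \in s -> unit_itv (coords A s y 0 i <= 0) (coords A s b 0 i).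

Definition natcomb (k : 'I_m -> nat) : 'rV[R]_d.+1 := (\row_i (k i)%:R) *m A.

Definition translate s b x :=
  exists2 k : 'I_m -> nat, (forall i, i \notin s -> k i = 0%N) &
    x = b + natcomb k.

Lemma coords_natcomb s k i : facet A s -> (forall i, i \notin s -> k i = 0%N) ->
  coords A s (natcomb k) 0 i = (k i)%:R.
Proof.
move=> [os _] ks; rewrite /natcomb coords_mul ?mxE //.
  exact: optimal_independent.
by move=> j /ks kj; rewrite mxE kj.
Qed.

Lemma translate_coords s b k i : facet A s ->
  (forall i, i \notin s -> k i = 0%N) ->
  coords A s (b + natcomb k) 0 i = coords A s b 0 i + (k i)%:R.
Proof. by move=> fs ks; rewrite coordsD mxE coords_natcomb. Qed.

Lemma translate_half_open s b x : facet A s -> in_box s b ->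
  translate s b x -> half_open A y s x.
Proof.
move=> fs bb [k ks ->] i si; rewrite translate_coords //.
move: (bb i si); rewrite /unit_itv; have : 0 <= (k i)%:R :> R by [].
by case: ifP => ? ? /andP[? ?]; split; lra.
Qed.

Lemma box_decomp s x : facet A s -> half_open A y s x ->
  exists2 b, in_box s b & translate s b x.
Proof.
move=> fs hx.
have H i : exists k : nat, (i \in s -> unit_itv (coords A s y 0 i <= 0)
    (coords A s x 0 i - k%:R)) /\ (i \notin s -> k = 0%N).
  have [si|si] := boolP (i \in s); last by exists 0%N.
  by have [c1 c2] := hx i si; have [k kP] := unit_itv_decomp c1 c2; exists k.
have [k kP] := choice H.
have ks i : i \notin s -> k i = 0%N by case: (kP i).
exists (x - natcomb k); last by exists k => //; rewrite subrK.
move=> i si.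
have -> : coords A s (x - natcomb k) 0 i = coords A s x 0 i - (k i)%:R.
  by rewrite -(coords_natcomb i fs ks) coordsB mxE [X in _ + X]mxE.
by case: (kP i) => + _; apply.
Qed.

Lemma box_unique s b b' x : facet A s -> in_box s b -> in_box s b' ->
  translate s b x -> translate s b' x -> b = b'.
Proof.
move=> fs bb bb' [k ks xk] [l ls xl].
suff kl : k = l by move: xk; rewrite xl kl => /addIr.
apply/funext => i; have [si|si] := boolP (i \in s); last by rewrite ks ?ls.
apply: (@unit_itv_unique R (coords A s y 0 i <= 0) (coords A s x 0 i)).
  by rewrite xk translate_coords // addrK; exact: bb.
by rewrite xl translate_coords // addrK; exact: bb'.
Qed.

(** The rows of [A] in [s] form a basis: the matrix [E] below selects them, and [E *m A] is both row
    free and row full, hence square. *)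
Lemma facet_enum s : facet A s ->
  exists2 f : 'I_d.+1 -> 'I_m, injective f & s = [set f i | i : 'I_d.+1]%SET.
Proof.
move=> [os fs]; have is_ := optimal_independent os.
pose E : 'M[R]_(#|s|, m) := \matrix_(i, j) (enum_val i == j)%:R.
have EE (w : 'rV[R]_#|s|) i : (w *m E) 0 (enum_val i) = w 0 i.
  rewrite mxE (bigD1 i) //= big1 ?addr0 => [|j ji]; rewrite mxE ?eqxx ?mulr1 //.
  by rewrite (inj_eq enum_val_inj) (negbTE ji) mulr0.
have ES (w : 'rV[R]_#|s|) : supported s (w *m E).
  move=> i si; rewrite mxE big1 // => j _; rewrite mxE.
  by case: eqP si => [<-|]; rewrite ?mulr0 // enum_valP.
have free : row_free (E *m A).
  rewrite -kermx_eq0; apply/eqP/row_matrixP => r.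
  rewrite row0; set w := row r _.
  have wEA : w *m E *m A = 0.
    by rewrite -mulmxA; apply/sub_kermxP; exact: row_sub.
  have wE := is_ _ (ES w) wEA.
  by apply/rowP => i; rewrite -EE wE !mxE.
have full : row_full (E *m A).
  rewrite -sub1mx; apply: (submx_trans (B := sel_mx R s *m A)).
    by rewrite sub1mx.
  suff /submxP[D ->] : (sel_mx R s <= E)%MS by rewrite -mulmxA submxMl.
  apply/row_subP => i.
  have [si|si] := boolP (i \in s); last first.
    suff -> : row i (sel_mx R s) = 0 by exact: sub0mx.
    by apply/rowP => j; rewrite !mxE (negbTE si) mul0rn.
  suff -> : row i (sel_mx R s) = row (enum_rank_in si i) E by exact: row_sub.
  by apply/rowP => j; rewrite !mxE enum_rankK_in // si; case: eqP.
have card_s : #|s| = d.+1.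
  by move/eqP: free; move/eqP: full => -> ->.
exists (fun i => enum_val (cast_ord (esym card_s) i)).
  by move=> i j /enum_val_inj /cast_ord_inj.
apply/setP => i; apply/idP/imsetP => [si|[j _ ->]]; last exact: enum_valP.
exists (cast_ord card_s (enum_rank_in si i)) => //.
by rewrite cast_ordK enum_rankK_in.
Qed.

Lemma coords_sum s x : facet A s -> \sum_(i in s) coords A s x 0 i = x 0 0.
Proof.
move=> fs; rewrite -[in RHS](facet_coordsK x fs) mulmx_height // big_mkcond /=.
by apply: eq_bigr => i _; case: ifPn => // si; rewrite coords_supported.
Qed.

(* The bound is strict because [y] has positive height, so some side of the
   box is closed at 0 and open at 1. *)
Lemma box_height s b : facet A s -> in_box s b -> 0 <= b 0 0 < d.+1%:R.
Proof.
move=> fs bb.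
have u01 i : i \in s -> 0 <= coords A s b 0 i <= 1.
  by move=> /bb; rewrite /unit_itv; case: ifP => _ /andP[? ?]; lra.
have [f finj fE] := facet_enum fs.
have card_s : #|s| = d.+1.
  by rewrite fE card_imset // card_ord.
(* Height 0 would force [y = 0], which lies in the zero span of the empty support; genericity
   excludes this. *)
have y0 : 0 < y 0 0.
  have [mu mu0 yE] := coney.
  have muy := mulmx_height A0 mu; rewrite -yE in muy.
  rewrite lt_neqAle muy sumr_ge0 ?andbT; last by move=> i _; exact: mu0.
  rewrite eq_sym -muy; apply/negP => /eqP y00.
  move: (y00); rewrite muy => /eqP; rewrite psumr_eq0; last by move=> i _; exact: mu0.
  move=> /allP mz.
  have m0 : mu = 0.
    by apply/rowP => i; rewrite mxE; apply/eqP/mz; rewrite mem_index_enum.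
  have y_0 : y = 0 by rewrite yE m0 mul0mx.
  have := @gen_y finset.set0; rewrite y_0 sub0mx => /(_ isT).
  suff -> : sel_mx R (finset.set0 : {set 'I_m}) *m A = 0.
    by rewrite /row_full mxrank0.
  suff -> : sel_mx R (finset.set0 : {set 'I_m}) = 0 by rewrite mul0mx.
  by apply/matrixP => i j; rewrite !mxE inE mul0rn.
have [i si ci] : exists2 i, i \in s & 0 < coords A s y 0 i.
  apply: contrapT => H; move: y0; rewrite -(coords_sum y fs) ltNge => /negP; apply.
  by apply: sumr_le0 => i si; rewrite leNgt; apply/negP => ci; apply: H; exists i.
rewrite -(coords_sum b fs) sumr_ge0 /=; last by move=> j /u01 /andP[].
rewrite (bigD1 i) //= -card_s (cardD1 i) si /= natrD.
apply: ltr_leD.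
  by move: (bb i si); rewrite /unit_itv leNgt ci /= => /andP[].
rewrite -[X in _ <= X]mulr1 mulr_natl -sumr_const.
have -> : \sum_(j in [predD1 s & i]) (1 : R) = \sum_(j in s | j != i) 1.
  by apply: eq_bigl => j; rewrite !inE andbC.
by apply: ler_sum => j /andP[/u01/andP[]].
Qed.

Lemma natcomb_height k : natcomb k 0 0 = (\sum_i k i)%N%:R.
Proof.
by rewrite /natcomb mulmx_height // natr_sum; apply: eq_bigr => i _; rewrite mxE.
Qed.

End Box.

(** * Counting lattice points of the cone *)

Section Pushforward.
Variables (p m : nat) (f : 'I_p -> 'I_m).
Hypothesis finj : injective f.

(** For injective [f] this is extension by zero along [f]; the form as a sum over fibres preserves
    the total. *)
Definition pushforward (t : 'I_p -> nat) (i : 'I_m) : nat :=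
  (\sum_(j | f j == i) t j)%N.

Lemma pushforward_im t j : pushforward t (f j) = t j.
Proof.
by rewrite /pushforward (big_pred1 j) // => k; rewrite /= (inj_eq finj).
Qed.

Lemma pushforward_out t i : i \notin [set f j | j : 'I_p]%SET ->
  pushforward t i = 0%N.
Proof.
move=> fi; rewrite /pushforward big_pred0 // => j; apply/negP => /eqP ji.
by move/negP: fi; apply; rewrite -ji imset_f.
Qed.

Lemma pushforward_sum t : (\sum_i pushforward t i = \sum_j t j)%N.
Proof. by rewrite [RHS](partition_big f predT). Qed.

Lemma pushforwardK (k : 'I_m -> nat) :
  (forall i, i \notin [set f j | j : 'I_p]%SET -> k i = 0%N) ->
  pushforward (k \o f) = k.
Proof.
move=> kf; apply/funext => i.
have [/imsetP[j _ ->]|fi] := boolP (i \in [set f j | j : 'I_p]%SET).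
  by rewrite pushforward_im.
by rewrite pushforward_out // kf.
Qed.

End Pushforward.

Lemma sum_unique (T : eqType) (r : seq T) (p : pred T) (x0 : T) :
  uniq r -> x0 \in r -> p x0 -> (forall x, x \in r -> p x -> x = x0) ->
  (\sum_(x <- r) p x = 1)%N.
Proof.
move=> ur rx px uni; rewrite -big_mkcond sum1_count.
have -> : count p r = count_mem x0 r.
  apply: eq_in_count => x xr /=; apply/idP/eqP => [/uni|->]//; exact.
by rewrite count_uniq_mem // rx.
Qed.

Section IntegerMatrix.
Variables (R : realType) (m n : nat).
Implicit Types M N : 'M[R]_(m, n).

Lemma mxOver_intD M N : M \is a mxOver Num.int -> N \is a mxOver Num.int ->
  M + N \is a mxOver Num.int.
Proof.
move=> /mxOverP Mi /mxOverP Ni; apply/mxOverP => i j.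
by rewrite mxE rpredD.
Qed.

Lemma mxOver_intB M N : M \is a mxOver Num.int -> N \is a mxOver Num.int ->
  M - N \is a mxOver Num.int.
Proof.
move=> /mxOverP Mi /mxOverP Ni; apply/mxOverP => i j.
by rewrite !mxE rpredB.
Qed.

End IntegerMatrix.

Section Count.
Variables (R : realType) (m d : nat) (A : 'M[R]_(m, d.+1)).
Hypothesis A0 : forall i, A i 0 = 1.
Hypothesis Aint : A \is a mxOver Num.int.
Variable y : 'rV[R]_d.+1.
Hypothesis coney : cone A y.
Hypothesis gen_y : forall s, (y <= sel_mx R s *m A)%MS ->
  row_full (sel_mx R s *m A).
Variable L : nat -> {fset 'rV[R]_d.+1}.
Hypothesis LP : forall n x, x \in L n <->
  [/\ x \is a mxOver Num.int, cone A x & x 0 0 = n%:R].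

Lemma natcomb_int k : natcomb A k \is a mxOver Num.int.
Proof.
rewrite /natcomb; apply/mxOverP => i j; rewrite mxE; apply: rpred_sum => l _.
by rewrite mxE rpredM ?natr_int //; move/mxOverP: Aint; apply.
Qed.

Lemma translate_count s b j n : facet A s -> in_box A y s b ->
  b \is a mxOver Num.int -> b 0 0 = j%:R -> (j <= d)%N ->
  count (fun x => `[< translate A s b x >]) (L n) = 'C(n + d - j, d).
Proof.
move=> fs bb bint bj jd.
have [f finj fE] := facet_enum fs.
(* Below height [j] no translate is reached, and the binomial vanishes because [n + d - j < d]. *)
have [nj|jn] := ltnP n j.
  rewrite bin_small; last by lia.
  apply/eqP; rewrite -leqn0 leqNgt -has_count; apply/negP => /hasP[x xn /asboolP].
  move=> [k _ xE]; have [_ _] := (LP n x).1 xn.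
  rewrite xE mxE bj natcomb_height // -natrD => /eqP; rewrite eqr_nat => /eqP.
  lia.
(* The remaining height [r] is distributed over the [d.+1] generators: weak compositions of [r],
   counted by stars and bars. *)
pose r := (n - j)%N.
pose S := [set t : d.+1.-tuple 'I_r.+1 | \sum_(i <- t) i == r]%N%SET.
have cS : #|S| = 'C(n + d - j, d).
  by rewrite card_ord_partitions /r; congr binomial; lia.
pose K (t : d.+1.-tuple 'I_r.+1) := pushforward f (fun i => tnth t i : nat).
have Ks t i : i \notin s -> K t i = 0%N.
  by rewrite fE; exact: pushforward_out.
pose g t := b + natcomb A (K t).
have ginj : injective g.
  move=> t t' /addrI /(congr1 (coords A s)) /rowP H.
  apply/eq_from_tnth => i; apply/val_inj/eqP; rewrite -(eqr_nat R); apply/eqP.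
  have := H (f i); rewrite !coords_natcomb //; try exact: Ks.
  by rewrite /K !pushforward_im.
rewrite -cS cardE -(size_map g) -size_filter; apply: perm_size.
apply: uniq_perm; rewrite ?filter_uniq ?fset_uniq ?map_inj_uniq ?enum_uniq //.
move=> x; rewrite mem_filter; apply/andP/mapP => [[/asboolP[k ks xE] xn]|[t]].
  have sk : (\sum_i k i = r)%N.
    have [_ _] := (LP n x).1 xn.
    rewrite xE mxE bj natcomb_height // -natrD => /eqP; rewrite eqr_nat => /eqP.
    rewrite /r; lia.
  pose t := [tuple inord (k (f i)) : 'I_r.+1 | i < d.+1].
  have tE i : tnth t i = k (f i) :> nat.
    rewrite tnth_mktuple inordK // ltnS -sk (bigD1 (f i)) //=.
    exact: leq_addr.
  have KE : K t = k.
    rewrite -[RHS](pushforwardK finj) -?fE // /K; congr pushforward.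
    by apply/funext => i; rewrite tE.
  exists t; last by rewrite /g KE.
  by rewrite mem_enum inE big_tuple -(pushforward_sum f) -/(K t) KE sk.
rewrite mem_enum inE big_tuple => /eqP tr ->.
have tb : translate A s b (g t) by exists (K t) => //; exact: Ks.
split; first exact/asboolP.
apply/LP; split.
- apply: mxOver_intD => //; exact: natcomb_int.
- apply: (half_open_cone fs); exact: (translate_half_open fs bb tb).
- rewrite /g mxE bj natcomb_height // -natrD /K pushforward_sum tr.
  by rewrite subnKC.
Qed.

(** The list [js] holds the heights of the lattice points of all boxes; the multiplicity of [j]
    plays the role of the h*-number of index [j]. *)
Lemma cone_count_generic : exists2 js : seq nat, all (fun j => j <= d)%N js &
  forall n, #|` L n| = (\sum_(j <- js) 'C(n + d - j, d))%N.
Proof.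
(* Lattice points of boxes have height at most [d], so this finite pool of cone points contains them
   all. *)
pose B : seq 'rV[R]_d.+1 := undup (flatten [seq (L j : seq _) | j <- iota 0 d.+1]).
pose Q := [seq q <- [seq (s, b) | s <- enum {set 'I_m}, b <- B] |
  `[< facet A q.1 /\ in_box A y q.1 q.2 >] ].
have mem_B b : b \in B -> exists2 j, (j <= d)%N & b \in L j.
  rewrite mem_undup => /flattenP[_ /mapP[j + ->]].
  by rewrite mem_iota add0n => /andP[_ jd] bj; exists j.
have mem_Q q : q \in Q -> [/\ facet A q.1, in_box A y q.1 q.2 & q.2 \in B].
  rewrite mem_filter => /andP[/asboolP[qf qb] /allpairsP[[s b] /= [_ bB qE]]].
  by split; rewrite // qE.
pose ht (q : {set 'I_m} * 'rV[R]_d.+1) := Num.truncn (q.2 0 0).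
have htP q : q \in Q -> [/\ q.2 \is a mxOver Num.int, q.2 0 0 = (ht q)%:R & (ht q <= d)%N].
  move=> /mem_Q[_ _ /mem_B[j jd /LP[qi _ qj]]].
  by rewrite /ht qj natrK.
exists [seq ht q | q <- Q].
  by apply/allP => _ /mapP[q /htP[_ _ ?] ->].
move=> n; rewrite big_map.
(* Double counting of pairs of a point and a translate containing it: each point lies in exactly one
   translate, each translate contributes one binomial. *)
transitivity (\sum_(x <- L n) \sum_(q <- Q) `[< translate A q.1 q.2 x >])%N; last first.
  rewrite exchange_big /=; apply: eq_big_seq => q qQ.
  have [qi qh qd] := htP q qQ; have [qf qb _] := mem_Q q qQ.
  by rewrite -big_mkcond sum1_count (translate_count _ qf qb qi qh).
rewrite -sum1_size.
apply: eq_big_seq => x xL; symmetry.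
have [xi xc xn] := (LP n x).1 xL.
have [s fs hs] := half_open_exists A0 coney gen_y xc.
have [b bb tb] := box_decomp fs hs.
have bi : b \is a mxOver Num.int.
  have [k _ xE] := tb.
  have -> : b = x - natcomb A k by rewrite xE addrK.
  apply: mxOver_intB => //; exact: natcomb_int.
have /andP[b0 b1] := box_height A0 coney gen_y fs bb.
have bB : b \in B.
  have bE : b 0 0 = (Num.truncn (b 0 0))%:R.
    by apply/esym/eqP; rewrite -natrEtruncn natrEint b0 andbT; move/mxOverP: bi; apply.
  rewrite mem_undup; apply/flattenP; exists (L (Num.truncn (b 0 0)) : seq _).
    apply/mapP; exists (Num.truncn (b 0 0)) => //.
    by rewrite mem_iota add0n /= -(ltr_nat R) -bE.
  apply/LP; split=> //; apply: (half_open_cone fs).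
  apply: (translate_half_open fs bb); exists (fun=> 0%N) => //.
  rewrite /natcomb; have -> : \row_(_ < m) 0%:R = 0 :> 'rV[R]_m by apply/rowP => i; rewrite !mxE.
  by rewrite mul0mx addr0.
apply: (@sum_unique _ _ _ (s, b)).
- apply/filter_uniq/allpairs_uniq; rewrite ?enum_uniq ?undup_uniq //.
  by move=> [? ?] [? ?] _ _ [-> ->].
- rewrite mem_filter /=; apply/andP; split; first exact/asboolP.
  by apply/allpairsP; exists (s, b); rewrite mem_enum.
- exact/asboolP.
- move=> [s' b'] /mem_Q[/= fs' bb' _] /asboolP /= tb'.
  have ss : s' = s.
    apply: (half_open_unique fs' fs _ hs); exact: (translate_half_open fs' bb' tb').
  by subst s'; congr pair; exact: (box_unique fs bb' bb tb' tb).
Qed.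

End Count.

Lemma cone_count (R : realType) (m d : nat) (A : 'M[R]_(m, d.+1))
    (L : nat -> {fset 'rV[R]_d.+1}) :
  (forall i, A i 0 = 1) -> A \is a mxOver Num.int -> row_full A ->
  (forall n x, x \in L n <->
    [/\ x \is a mxOver Num.int, cone A x & x 0 0 = n%:R]) ->
  exists2 js : seq nat, all (fun j => j <= d)%N js &
    forall n, #|` L n| = (\sum_(j <- js) 'C(n + d - j, d))%N.
Proof.
move=> A0 Aint Afull LP; have [y coney gen_y] := exists_generic Afull.
exact: (cone_count_generic A0 Aint coney gen_y LP).
Qed.

(** * Lattice polytopes *)

Section Hull.
Variables (R : realType) (d : nat).

(** Fixing a list of generators as the rows of [V] turns convex combinations into matrix
    products. *)
Definition hull_mx m (V : 'M[R]_(m, d)) : set 'rV[R]_d :=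
  [set x | exists mu : 'rV[R]_m,
    [/\ nonneg mu, \sum_i mu 0 i = 1 & x = mu *m V]].

Lemma polytope_hull_mx (P : set 'rV[R]_d) : is_polytope P ->
  exists m (V : 'M[R]_(m, d)), P = hull_mx V.
Proof.
move=> [S Sfin ->].
pose X : seq 'rV[R]_d := fset_set S.
have XS v : v \in X <-> S v.
  by rewrite in_fset_set // inE.
exists (size X), (\matrix_(i < size X) nth 0 X i).
apply/seteqP; split=> x /=.
  move=> [m [a [w [aS w0 w1 ->]]]].
  have cP i : (index (a i) X < size X)%N by rewrite index_mem; apply/XS.
  pose c i := Ordinal (cP i).
  exists (\row_j \sum_(i | c i == j) w i); split.
  - by move=> j; rewrite mxE sumr_ge0.
  - rewrite -w1 [RHS](partition_big c predT) //=.
    by apply: eq_bigr => j _; rewrite mxE.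
  - rewrite mulmx_sum_row (partition_big c predT) //=.
    apply: eq_bigr => j _; rewrite mxE scaler_suml; apply: eq_bigr => i /eqP <-.
    by rewrite rowK nth_index //; apply/XS.
move=> [mu [mu0 mu1 ->]].
exists (size X), (fun i => nth 0 X i), (fun i => mu 0 i); split=> //.
  by move=> i; apply/XS; rewrite mem_nth.
by rewrite mulmx_sum_row; apply: eq_bigr => i _; rewrite rowK.
Qed.

Lemma sum_weights_le m (mu : 'rV[R]_m) i : nonneg mu -> \sum_i mu 0 i = 1 ->
  mu 0 i <= 1.
Proof.
move=> mu0 <-; rewrite (bigD1 i) //= lerDl sumr_ge0 //.
Qed.

Lemma mul_weight1 m (V : 'M[R]_(m, d)) (mu : 'rV[R]_m) i : nonneg mu ->
  \sum_i mu 0 i = 1 -> mu 0 i = 1 -> mu *m V = row i V.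
Proof.
move=> mu0 mu1 mui; rewrite mulmx_sum_row (bigD1 i) //= mui scale1r.
rewrite big1 ?addr0 // => j ji.
have : \sum_(j | j != i) mu 0 j = 0.
  by move: mu1; rewrite (bigD1 i) //= mui => /(canRL (addKr _)) ->; rewrite addNr.
move=> /eqP; rewrite psumr_eq0; last by move=> k _; exact: mu0.
move=> /allP/(_ j (mem_index_enum j)); rewrite ji /= => /eqP ->.
by rewrite scale0r.
Qed.

Lemma hull_mx_vertex m (V : 'M[R]_(m.+1, d)) i0 :
  is_vertex (hull_mx V) (row i0 V) \/
  exists V' : 'M[R]_(m, d), hull_mx V = hull_mx V'.
Proof.
have split_sum (mu : 'rV[R]_m.+1) :
    mu *m V = mu 0 i0 *: row i0 V + (\row_j mu 0 (lift i0 j)) *m row' i0 V.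
  rewrite mulmx_sum_row (bigD1_ord i0) //= [in RHS]mulmx_sum_row; congr (_ + _).
  by apply: eq_bigr => j _; rewrite mxE; congr (_ *: _); apply/rowP => k; rewrite !mxE.
have [red|irr] := pselect (hull_mx (row' i0 V) (row i0 V)).
  right; exists (row' i0 V); apply/seteqP; split=> x.
    move: red => [nu [nu0 nu1 nuE]] [mu [mu0 mu1 ->]].
    exists (mu 0 i0 *: nu + \row_j mu 0 (lift i0 j)); split.
    - move=> j; rewrite !mxE; apply: addr_ge0; last exact: mu0.
      by apply: mulr_ge0; [exact: mu0|exact: nu0].
    - under eq_bigr do rewrite !mxE.
      rewrite big_split /= -mulr_sumr nu1 mulr1.
      by rewrite -mu1 (bigD1_ord i0).
    - by rewrite split_sum nuE mulmxDl scalemxAl.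
  move=> [nu [nu0 nu1 ->]].
  pose mu : 'rV[R]_m.+1 := \row_i (if unlift i0 i is Some j then nu 0 j else 0).
  have mui0 : mu 0 i0 = 0 by rewrite mxE unlift_none.
  have mul j : mu 0 (lift i0 j) = nu 0 j by rewrite mxE liftK.
  exists mu; split.
  - by move=> i; rewrite mxE; case: (unlift i0 i) => // j; exact: nu0.
  - by rewrite (bigD1_ord i0) //= mui0 add0r -nu1; apply: eq_bigr => j _.
  - rewrite split_sum mui0 scale0r add0r; congr mulmx.
    by apply/rowP => j; rewrite [RHS]mxE mul.
left; split.
  exists (delta_mx 0 i0); split.
  - by move=> i; rewrite mxE ler0n.
  - rewrite (bigD1 i0) //= big1 ?addr0 => [|i ii0]; rewrite mxE eqxx ?eqxx //=.
    by rewrite (negbTE ii0).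
  - by rewrite -rowE.
move=> x y t [a [a0 a1 ->]] [b [b0 b1 ->]] /andP[t0 t1] vE.
pose c := t *: a + (1 - t) *: b.
have c0 : nonneg c.
  move=> i; rewrite !mxE; have := a0 i; have := b0 i; nra.
have c1 : \sum_i c 0 i = 1.
  under eq_bigr do rewrite !mxE.
  by rewrite big_split /= -!mulr_sumr a1 b1; lra.
have cV : row i0 V = c *m V by rewrite vE mulmxDl -!scalemxAl.
(* With a weight below 1, dividing the other weights by [1 - c 0 i0] would write row [i0] as a
   convex combination of the other rows. *)
have ci1 : c 0 i0 = 1.
  apply: contrapT => ci; apply: irr.
  have ci_lt : c 0 i0 < 1.
    by rewrite lt_neqAle sum_weights_le // andbT; apply/eqP.
  have ci_gt : 0 < 1 - c 0 i0 by lra.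
  exists (\row_j ((1 - c 0 i0)^-1 * c 0 (lift i0 j))); split.
  - move=> j; rewrite mxE; apply: mulr_ge0; last exact: c0.
    by rewrite invr_ge0 ltW.
  - under eq_bigr do rewrite mxE.
    rewrite -mulr_sumr; apply: (mulfI (lt0r_neq0 ci_gt)).
    rewrite mulrA divff ?lt0r_neq0 // mul1r mulr1.
    by move: c1; rewrite (bigD1_ord i0) //= => c1; lra.
  - have -> : \row_j ((1 - c 0 i0)^-1 * c 0 (lift i0 j)) =
        (1 - c 0 i0)^-1 *: \row_j c 0 (lift i0 j).
      by apply/rowP => j; rewrite !mxE.
    rewrite -scalemxAl.
    have <- : (1 - c 0 i0) *: row i0 V = (\row_j c 0 (lift i0 j)) *m row' i0 V.
      by rewrite scalerBl scale1r [X in X - _]cV split_sum addrC addKr.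
    by rewrite scalerK // lt0r_neq0.
have ai := sum_weights_le i0 a0 a1; have bi := sum_weights_le i0 b0 b1.
have cE : c 0 i0 = t * a 0 i0 + (1 - t) * b 0 i0 by rewrite !mxE.
have a_i : a 0 i0 = 1 by apply: le_anti; rewrite ai /=; nra.
have b_i : b 0 i0 = 1 by apply: le_anti; rewrite bi /=; nra.
by rewrite !(mul_weight1 _ _ _ (i := i0)).
Qed.

Lemma lattice_polytope_hull_mx (P : set 'rV[R]_d) : is_lattice_polytope P ->
  exists m (V : 'M[R]_(m, d)), V \is a mxOver Num.int /\ P = hull_mx V.
Proof.
move=> [Ppol Pvert].
pose p m := `[< exists V : 'M[R]_(m, d), P = hull_mx V >].
have pex : exists m, p m.
  by have [m [V PV]] := polytope_hull_mx Ppol; exists m; apply/asboolP; exists V.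
case: (ex_minnP pex) => m /asboolP[V PV] mmin; exists m, V; split=> //.
apply/mxOverP => i j; case: m V PV mmin i => [|m] V PV mmin i; first by case: i.
have [vi|[V' VV']] := hull_mx_vertex V i; last first.
  have : p m by apply/asboolP; exists V'; rewrite PV.
  by move=> /mmin; rewrite ltnn.
have [|z _ zE] := Pvert (row i V); first by rewrite PV.
move/rowP: zE => /(_ j); rewrite !mxE => <-.
exact: intr_int.
Qed.

Lemma integer_latticeP (z : 'rV[R]_d) : integer_lattice z <-> z \is a mxOver Num.int.
Proof.
split=> [[u _ <-]|/mxOverP zi].
  by apply/mxOverP => i j; rewrite mxE intr_int.
exists (\row_j Num.floor (z 0 j)) => //; apply/rowP => j.
by rewrite !mxE floorK.
Qed.

(** * Homogenization: the cone over a polytope *)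

Definition homogenize m (V : 'M[R]_(m, d)) : 'M[R]_(m, d.+1) :=
  row_mx (const_mx 1 : 'M_(m, 1)) V.

Definition lift_height (n : nat) (z : 'rV[R]_d) : 'rV[R]_d.+1 :=
  row_mx (const_mx n%:R : 'M_1) z.

Lemma lift_height_inj n : injective (lift_height n).
Proof. by move=> z z' /(@eq_row_mx R 1 1 d _ _ _ _)[_]. Qed.

Lemma row_mx00 m (B : 'M[R]_(m, 1)) (C : 'M[R]_(m, d)) i :
  (row_mx B C : 'M[R]_(m, d.+1)) i 0 = B i 0.
Proof.
rewrite -(row_mxEl B C i 0); congr (row_mx B C i _); exact: val_inj.
Qed.

Lemma lift_height0 n z : lift_height n z 0 0 = n%:R.
Proof. by rewrite /lift_height row_mx00 mxE. Qed.

Lemma lift_heightS n z j : lift_height n z 0 (lift ord0 j) = z 0 j.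
Proof.
rewrite -(row_mxEr (const_mx n%:R : 'M[R]_1) z).
by congr (row_mx _ _ _ _); apply: val_inj.
Qed.

Lemma row_split_eq (u v : 'rV[R]_d.+1) : u 0 0 = v 0 0 ->
  (forall j, u 0 (lift ord0 j) = v 0 (lift ord0 j)) -> u = v.
Proof. by move=> uv0 uvS; apply/rowP => i; case: (unliftP 0 i) => [j|] ->. Qed.

Lemma homogenize0 m (V : 'M[R]_(m, d)) i : homogenize V i 0 = 1.
Proof. by rewrite /homogenize row_mx00 mxE. Qed.

Lemma row_mx_int m (B : 'M[R]_(m, 1)) (C : 'M[R]_(m, d)) :
  ((row_mx B C : 'M[R]_(m, d.+1)) \is a mxOver Num.int) <->
  B \is a mxOver Num.int /\ C \is a mxOver Num.int.
Proof.
split=> [/mxOverP H|[/mxOverP HB /mxOverP HC]].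
  split; apply/mxOverP => i j.
    by rewrite -(row_mxEl B C); exact: H.
  by rewrite -(row_mxEr B C); exact: H.
apply/mxOverP => i j; have [k ->|k ->] := @split_ordP 1 d j.
  by have := HB i k; rewrite -(row_mxEl B C).
by have := HC i k; rewrite -(row_mxEr B C).
Qed.

Lemma mul_homogenize m (V : 'M[R]_(m, d)) (mu : 'rV[R]_m) :
  mu *m homogenize V = row_mx (const_mx (\sum_i mu 0 i) : 'M_1) (mu *m V).
Proof.
apply: (etrans (@mul_mx_row R 1 m 1 d mu (const_mx 1) V)); congr row_mx.
apply/matrixP => i j; rewrite !mxE !ord1; apply: eq_bigr => k _.
by rewrite mxE mulr1.
Qed.

Lemma cone_homogenize m (V : 'M[R]_(m, d)) n z : hull_mx V !=set0 ->
  cone (homogenize V) (lift_height n z) <-> dilate n (hull_mx V) z.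
Proof.
move=> [p Vp]; split.
  move=> [mu mu0]; rewrite mul_homogenize => /(@eq_row_mx R 1 1 d _ _ _ _)[/matrixP /(_ 0 0)].
  rewrite !mxE => mun ->.
  (* At height 0 all weights vanish, and the dilate by 0 contains the origin because the hull is
     nonempty. *)
  case: n mun => [|n] mun.
    have muz : mu = 0.
      apply/rowP => i; rewrite mxE; apply/eqP; move/esym/eqP: mun.
      rewrite psumr_eq0; last by move=> k _; exact: mu0.
      by move=> /allP/(_ i (mem_index_enum i)).
    by exists p => //; rewrite muz mul0mx scale0r.
  exists ((n.+1%:R^-1 *: mu) *m V).
    exists (n.+1%:R^-1 *: mu); split=> //.
    - by move=> i; rewrite mxE; apply: mulr_ge0; [rewrite invr_ge0|exact: mu0].
    - under eq_bigr do rewrite mxE.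
      by rewrite -mulr_sumr -mun mulVf // pnatr_eq0.
  by rewrite -scalemxAl scalerA divff ?scale1r // pnatr_eq0.
move=> [x [mu [mu0 mu1 ->]] <-]; exists (n%:R *: mu).
  by move=> i; rewrite mxE; apply: mulr_ge0 => //; exact: mu0.
rewrite mul_homogenize -scalemxAl.
suff -> : \sum_i (n%:R *: mu) 0 i = n%:R by [].
by under eq_bigr do rewrite mxE; rewrite -mulr_sumr mu1 mulr1.
Qed.

(** Shifting the coordinates by [N] encodes these points as vectors with entries in
    ['I_(N.*2.+1)]. *)
Lemma finite_bounded_lattice (N : nat) :
  finite_set [set z : 'rV[R]_d | integer_lattice z /\ forall j, `|z 0 j| <= N%:R].
Proof.
pose f (w : 'rV['I_(N.*2.+1)]_d) : 'rV[R]_d := \row_j ((w 0 j)%:R - N%:R).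
apply: (@sub_finite_set _ _ (range f)); last exact/finite_image/finite_finset.
move=> z [/integer_latticeP/mxOverP zi zN] /=.
exists (\row_j inord (absz (Num.floor (z 0 j) + N%:Z)%R)) => //; apply/rowP => j.
rewrite !mxE; have := zN j; have /intrP[k ->] := zi 0 j.
rewrite intrKfloor ler_norml => /andP[z1 z2].
have k1 : - N%:Z <= k by rewrite -(ler_int R) rmorphN.
have k2 : k <= N%:Z by rewrite -(ler_int R).
rewrite inordK; last by lia.
by rewrite !pmulrn -intrB; congr (_%:~R); lia.
Qed.

Lemma finite_dilate m (V : 'M[R]_(m, d)) n :
  finite_set (dilate n (hull_mx V) `&` @integer_lattice R d).
Proof.
pose B := \sum_i \sum_j `|V i j|.
apply: sub_finite_set (finite_bounded_lattice (Num.truncn (n%:R * B)).+1).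
move=> z [[x [mu [mu0 mu1 ->]] <-] zi]; split=> // j.
apply/ltW; apply: le_lt_trans (truncnS_gt _).
rewrite mxE normrM ger0_norm // ler_wpM2l // mxE.
apply: le_trans (ler_norm_sum _ _ _) _.
apply: ler_sum => i _; rewrite normrM ger0_norm; last exact: mu0.
apply: (@le_trans _ _ `|V i j|).
  by rewrite ler_piMl // sum_weights_le.
by rewrite (bigD1 j) //= lerDl sumr_ge0 //.
Qed.

(** The affine hull is the whole space, so combinations of the rows reach every vector of height 1,
    and these span. *)
Lemma homogenize_full m (V : 'M[R]_(m, d)) : has_dimension (hull_mx V) d ->
  row_full (homogenize V).
Proof.
move=> [x0 [U [UE Ud]]].
have Ufull : U = fullv.
  by apply/eqP; rewrite eqEdim subvf /= Ud dimvf /dim /= mul1n.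
have aff x : affine_hull (hull_mx V) x.
  by rewrite UE; exists (x - x0); rewrite ?subrKC //= Ufull memvf.
have sub1 x : (lift_height 1 x <= homogenize V)%MS.
  have [k [a [w [aV w1 ->]]]] := aff x.
  have -> : lift_height 1 (\sum_i w i *: a i) = \sum_i w i *: lift_height 1 (a i).
    apply: row_split_eq => [|j].
      rewrite lift_height0 summxE -[LHS]w1; apply: eq_bigr => i _.
      by rewrite [RHS]mxE lift_height0 mulr1.
    rewrite lift_heightS !summxE; apply: eq_bigr => i _.
    by rewrite mxE [RHS]mxE lift_heightS.
  apply: summx_sub => i _; apply: scalemx_sub.
  have [mu [mu0 mu1 ->]] := aV i.
  by rewrite /lift_height -mu1 -mul_homogenize submxMl.
rewrite -sub1mx; apply/row_subP => r; set u := row r _.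
have -> : u = (u 0 0 - 1) *: lift_height 1 0 + lift_height 1 (\row_j u 0 (lift ord0 j)).
  apply: row_split_eq => [|j]; rewrite [RHS]mxE [X in _ = X + _]mxE.
    by rewrite !lift_height0 mulr1 subrK.
  by rewrite !lift_heightS [X in _ * X]mxE mulr0 add0r [RHS]mxE.
by rewrite addmx_sub ?scalemx_sub.
Qed.

Lemma hull_mx_count m (V : 'M[R]_(m, d)) :
  V \is a mxOver Num.int -> has_dimension (hull_mx V) d ->
  hull_mx V !=set0 ->
  exists2 js : seq nat, all (fun j => j <= d)%N js &
    forall n, lattice_count (hull_mx V) n = (\sum_(j <- js) 'C(n + d - j, d))%N.
Proof.
move=> Vint Vdim V0.
pose L n : {fset 'rV[R]_d.+1} := [fset lift_height n z | z in
  fset_set (dilate n (hull_mx V) `&` @integer_lattice R d)]%fset.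
have LP n x : x \in L n <->
    [/\ x \is a mxOver Num.int, cone (homogenize V) x & x 0 0 = n%:R].
  split.
    move=> /imfsetP[z /= + ->]; rewrite in_fset_set; last exact: finite_dilate.
    rewrite inE => -[zd /integer_latticeP zi]; split.
    - apply/row_mx_int; split=> //; apply/mxOverP => i j.
      by rewrite mxE natr_int.
    - exact/cone_homogenize.
    - exact: lift_height0.
  move=> [xi xc xn].
  have xE : x = lift_height n (\row_j x 0 (lift ord0 j)).
    apply: row_split_eq => [|j]; first by rewrite lift_height0.
    by rewrite lift_heightS mxE.
  apply/imfsetP; exists (\row_j x 0 (lift ord0 j)) => //=.
  rewrite in_fset_set ?inE; last exact: finite_dilate.
  split; first by apply/cone_homogenize => //; rewrite -xE.
  apply/integer_latticeP.
  have : lift_height n (\row_j x 0 (lift ord0 j)) \is a mxOver Num.int by rewrite -xE.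
  by move=> /row_mx_int[].
have Aint : homogenize V \is a mxOver Num.int.
  by apply/row_mx_int; split=> //; apply/mxOverP => i j; rewrite mxE rpred1.
have [js jd jsE] := cone_count (@homogenize0 m V) Aint (homogenize_full Vdim) LP.
exists js => // n; rewrite -jsE /lattice_count /L card_imfset //=.
exact: lift_height_inj.
Qed.

(** The weights of an affine combination sum to 1, so the sum cannot be empty. *)
Lemma dimension_nonempty (P : set 'rV[R]_d) k : has_dimension P k -> P !=set0.
Proof.
move=> [x0 [U [UE _]]].
have : affine_hull P x0 by rewrite UE; exists 0; rewrite ?addr0 //= mem0v.
move=> [[|m] [a [w [aP w1 _]]]]; last by exists (a ord0).
by move: w1; rewrite big_ord0 => /eqP; rewrite eq_sym oner_eq0.
Qed.

Lemma lattice_count0 (P : set 'rV[R]_d) : P !=set0 -> lattice_count P 0 = 1%N.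
Proof.
move=> [p Pp]; rewrite /lattice_count.
suff -> : dilate 0 P `&` @integer_lattice R d = [set 0] by rewrite fset_set1 cardfs1.
apply/seteqP; split=> z /=; first by move=> [[x _ <-] _]; rewrite scale0r.
move=> ->; split; first by exists p; rewrite ?scale0r.
by apply/integer_latticeP/mxOverP => i j; rewrite mxE rpred0.
Qed.

End Hull.

(** * Binomial inequalities and finite differences *)

(** Trinomial revision: for [j <= k] both sides are d! / (j! (k - j)! (d - k)!). *)
Lemma bin_trinomial d k j : (j <= d)%N -> (k <= d)%N ->
  ('C(d, j) * 'C(d - j, d - k) = 'C(d, k) * 'C(k, j))%N.
Proof.
move=> jd kd; have [kj|jk] := ltnP k j.
  by rewrite (@bin_small (d - j)) 1?(@bin_small k) ?muln0 //; lia.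
apply/eqP; rewrite -(eqn_pmul2r (fact_gt0 j)) -(eqn_pmul2r (fact_gt0 (d - k))).
rewrite -(eqn_pmul2r (fact_gt0 (k - j))); apply/eqP.
have e1 := bin_fact jd; have e2 := bin_fact kd; have e3 := bin_fact jk.
have e4 : ('C(d - j, d - k) * ((d - k)`! * (k - j)`!) = (d - j)`!)%N.
  rewrite -(@bin_fact (d - j) (d - k)); last by lia.
  by have -> : (d - j - (d - k) = k - j)%N by lia.
transitivity (d`!).
  by rewrite -e1 -e4; ring.
by rewrite -e2 -e3; ring.
Qed.

(** Multiplied by ['C(d, j)], the two sides become ['C(d, k) * 'C(d, l)] times ['C(k, j)] and
    ['C(l, j)] respectively. *)
Lemma bin_ratio_le d k l j : (j <= d)%N -> (k <= l)%N -> (l <= d)%N ->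
  ('C(d, l) * 'C(d - j, d - k) <= 'C(d, k) * 'C(d - j, d - l))%N.
Proof.
move=> jd kl ld; have dj : (0 < 'C(d, j))%N by rewrite bin_gt0.
rewrite -(leq_pmul2l dj) mulnCA [X in (_ <= X)%N]mulnCA !bin_trinomial //;
  last exact: leq_trans ld.
by rewrite mulnCA !leq_mul // leq_bin2l.
Qed.

(** * Newton expansion in the binomial basis *)

Section Newton.
Variable R : realType.

Lemma fdiffn_sum (I : Type) (r : seq I) (c : I -> R) (f : I -> nat -> R) k n :
  fdiffn k (fun n => \sum_(i <- r) c i * f i n) n =
  \sum_(i <- r) c i * fdiffn k (f i) n.
Proof.
elim: k n => [//|k IH] n; rewrite /fdiffn !iterS -/(fdiffn k _) /fdiff !IH.
by rewrite -sumrB; apply: eq_bigr => i _; rewrite mulrBr.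
Qed.

(** By Pascal's rule each difference lowers the lower index by one, until the constant 1 becomes
    0. *)
Lemma fdiffn_bin k i n :
  fdiffn k (fun n => 'C(n, i)%:R : R) n = if (k <= i)%N then 'C(n, i - k)%:R else 0.
Proof.
elim: k n => [|k IH] n; first by rewrite subn0.
rewrite /fdiffn iterS -/(fdiffn k _) /fdiff !IH.
have [ki|ik|<-] := ltngtP k i; last 2 first.
- by rewrite subrr.
- by rewrite subnn !bin0 subrr.
by rewrite -(subnSK ki) binS natrD addrC addKr.
Qed.

Lemma fdiffn_newton d (c : nat -> R) k : (k <= d)%N ->
  fdiffn k (fun n => \sum_(i < d.+1) c i * 'C(n, i)%:R) 0 = c k.
Proof.
move=> kd; rewrite fdiffn_sum (bigD1 (Ordinal (kd : (k < d.+1)%N))) //= fdiffn_bin.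
rewrite leqnn subnn bin0 mulr1 big1 ?addr0 // => i ik; rewrite fdiffn_bin.
case: ifP => [ki|]; rewrite ?mulr0 // bin0n subn_eq0.
have -> : (i <= k)%N = false; last by rewrite mulr0.
by apply/negbTE; rewrite -ltnNge ltn_neqAle ki andbT eq_sym -(inj_eq val_inj) in ik *.
Qed.

Lemma prod_ffact k n : \prod_(i < k) (n%:R - i%:R) = (n ^_ k)%:R :> R.
Proof.
elim: k => [|k IH]; first by rewrite big_ord0 ffactn0.
rewrite big_ord_recr /= IH ffactnSr natrM.
have [kn|nk] := leqP k n; first by rewrite natrB.
by rewrite ffact_small // !mul0r.
Qed.

(** The binomial ['C(n, i)] is the monic falling factorial [b i] divided by i!, so only [i = d]
    contributes in degree [d]. *)
Lemma newton_coef d (c : nat -> R) (p : {poly R}) :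
  (forall n : nat, p.[n%:R] = \sum_(i < d.+1) c i * 'C(n, i)%:R) ->
  d`!%:R * p`_d = c d.
Proof.
move=> pE; have f0 i : i`!%:R != 0 :> R by rewrite pnatr_eq0 -lt0n fact_gt0.
pose b k : {poly R} := \prod_(i < k) ('X - i%:R%:P).
have size_b k : size (b k) = k.+1.
  by rewrite size_prod_XsubC [index_enum _]unlock -enumT size_enum_ord.
pose q := \sum_(i < d.+1) (c i / i`!%:R) *: b i.
have -> : p = q.
  (* A nonzero [p - q] would have too many roots, as [p] and [q] agree at all natural numbers. *)
  apply/eqP; rewrite -subr_eq0; apply/negP => /negP pq0.
  pose rs : seq R := [seq i%:R | i <- iota 0 (size (p - q))].
  suff : (size rs < size (p - q)%R)%N by rewrite size_map size_iota ltnn.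
  apply: max_poly_roots => //; last first.
    by rewrite map_inj_uniq ?iota_uniq // => i j /eqP; rewrite eqr_nat => /eqP.
  apply/allP => _ /mapP[n _ ->]; rewrite rootE hornerD hornerN subr_eq0 pE.
  rewrite horner_sum; apply/eqP/eq_bigr => i _.
  rewrite hornerZ horner_prod -mulrA; congr (_ * _).
  under eq_bigr do rewrite hornerXsubC.
  by rewrite prod_ffact -bin_ffact natrM mulrCA mulVf // mulr1.
rewrite coef_sum big_ord_recr /= big1 ?add0r => [|i _]; rewrite coefZ.
  have bd : (b d)`_d = 1.
    have : b d \is monic by apply: monic_prod_XsubC.
    by rewrite monicE /lead_coef size_b => /eqP.
  by rewrite bd mulr1 mulrC divfK.
by rewrite nth_default ?mulr0 // size_b.
Qed.

End Newton.

(** * Inequalities between the differences of the Ehrhart polynomial *)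

Theorem theorem1p1 (R : realType) (d : nat) (hd : (1 <= d)%N)
  (P : set 'rV[R]_d) (hP : is_lattice_polytope P) (hdim : has_dimension P d)
  (i_P : {poly R}) (hE : is_ehrhart_poly P i_P) :
  (forall k l : nat, (k < l)%N -> (l <= d)%N ->
     'C(d, l)%:R * fdiffn k (fun n : nat => i_P.[n%:R]) 0%N
       <= 'C(d, k)%:R * fdiffn l (fun n : nat => i_P.[n%:R]) 0%N)
  /\
  (forall k : nat, (k <= d)%N ->
     'C(d, k)%:R <= fdiffn k (fun n : nat => i_P.[n%:R]) 0%N
     /\ fdiffn k (fun n : nat => i_P.[n%:R]) 0%N
          <= 'C(d, k)%:R * (d`!)%:R * i_P`_d).
Proof.
have P0 := dimension_nonempty hdim.
have [m [V [Vint PV]]] := lattice_polytope_hull_mx hP.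
have [js jd countE] : exists2 js : seq nat, all (fun j => j <= d)%N js &
    forall n, lattice_count P n = (\sum_(j <- js) 'C(n + d - j, d))%N.
  by rewrite PV in P0 hdim *; exact: hull_mx_count.
(* These are the Newton coefficients of [i_P]: Vandermonde's convolution expands
   ['C(n + (d - j), d)] in the ['C(n, i)]. *)
pose c k : R := \sum_(j <- js) 'C(d - j, d - k)%:R.
have newton n : i_P.[n%:R] = \sum_(i < d.+1) c i * 'C(n, i)%:R.
  rewrite hE countE natr_sum.
  under [RHS]eq_bigr do rewrite /c mulr_suml.
  rewrite exchange_big /=; apply: eq_big_seq => j /(allP jd) jle.
  rewrite -addnBA // -binomial.Vandermonde natr_sum.
  by apply: eq_bigr => i _; rewrite natrM mulrC.
have diffE k : (k <= d)%N -> fdiffn k (fun n : nat => i_P.[n%:R]) 0%N = c k.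
  move=> kd; rewrite -(fdiffn_newton c kd); congr (fdiffn k _ 0%N).
  exact/funext.
have c0 : c 0%N = 1.
  by rewrite -diffE // /fdiffn /= hE lattice_count0.
have cd := newton_coef newton.
(* Allowing [k = l] makes both bounds of the second claim instances for every [k <= d]. *)
have ineq k l : (k <= l)%N -> (l <= d)%N -> 'C(d, l)%:R * c k <= 'C(d, k)%:R * c l.
  move=> kl ld; rewrite /c !mulr_sumr.
  rewrite big_seq [leRHS]big_seq; apply: ler_sum => j /(allP jd) jle.
  by rewrite -!natrM ler_nat bin_ratio_le.
split=> [k l kl ld|k kd].
  rewrite !diffE //; last exact: leq_trans (ltnW kl) ld.
  exact: ineq (ltnW kl) ld.
(* The lower bound compares index 0, where [c 0 = 1], with [k]; the upper bound compares [k] with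
   [d], where [c d] is d! times the coefficient of degree [d]. *)
rewrite diffE //; split.
  by have := ineq _ _ (leq0n k) kd; rewrite c0 bin0 mulr1 mul1r.
by have := ineq _ _ kd (leqnn d); rewrite binn mul1r -cd mulrA.
Qed.
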